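(* Let $V$ be a real normed space of finite dimension $d\ge 1$, let $U$ be an abelian group with a translation-invariant ultrametric, let $\Lambda\subset V\times U$ be a closed additive subgroup, and let $X=(V\times U)/\Lambda$ carry the quotient metric induced by the maximum product metric. Let $\alpha\in X$ have strict best-return denominators $q_1<q_2<\cdots$, and let $\overline V$ be the reduced real factor. Then $$q_{n+P(\overline V)+1}>q_n+q_{n+1}$$ for every $n\ge1$ for which the left-hand side is defined. If $V$ is an inner-product space, then, with $E_\Lambda$ the effective real factor, the stronger bound $$q_{n+P(E_\Lambda)+1}>q_n+q_{n+1}$$ holds for every $n\ge1$ for which the left-hand side is defined.
   Context: Metric setting. Write the ultrametric on $U$ as $d_U(u,w)=|u-w|_U$, so $|u+w|_U\le\max\{|u|_U,|w|_U\}$. On $V\times U$ put $|(v,u)|=\max\{\|v\|_V,|u|_U\}$; ''closed'' refers to the induced metric topology. On $X=(V\times U)/\Lambda$ put $\|a+\Lambda\|_X=\inf_{\lambda\in\Lambda}|a-\lambda|$ and $d_X(x,y)=\|x-y\|_X$. The infimum need not be attained. Best returns. For positive integers $q$ put $\rho(q)=d_X(q\alpha,0)$. The strict best-return denominators of $\alpha$ are $q_1=1$ and $q_{n+1}=\min\{q>q_n:\rho(q)<\rho(q_n)\}$ as long as such $q$ exists; the sequence may terminate, and a zero return (if any) is retained as its final term. Packing number. For a finite-dimensional real normed space $Y$, $P(Y)$ is the maximal cardinality of a set $S\subset\{v\in Y:\|v\|_Y<1\}$ (open unit ball) with $\|v-w\|_Y\ge1$ for all distinct $v,w\in S$. This maximum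 is finite, and $P(\{0\})=1$. Reduced real factor. $W=\{v\in V:(tv,0)\in\Lambda\text{ for every }t\in\mathbb R\}$, a linear subspace of $V$; $\overline V=V/W$ with the quotient norm. Effective real factor (when $V$ is an inner-product space). Let $\pi:V\to W^\perp$ be orthogonal projection. Then $E_\Lambda=\operatorname{span}_{\mathbb R}\{\pi(v):(v,u)\in\Lambda\}\subset W^\perp$, with the induced inner product and norm. *)

(* Defs.v *)
From HB Require Import structures.
From mathcomp Require Import all_boot all_order all_algebra.
From mathcomp Require Import all_classical all_reals topology normedtype.

Set Implicit Arguments.
Unset Strict Implicit.
Unset Printing Implicit Defensive.

Import Order.TTheory GRing.Theory Num.Theory.
Import numFieldNormedType.Exports.

Local Open Scope classical_set_scope.
Local Open Scope card_scope.
Local Open Scope ring_scope.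

(* Abelian groups with a translation-invariant ultrametric.  MathComp's
   normedZmodType does not apply: it requires |x *+ n| = |x| *+ n, which an
   ultrametric absolute value violates.  Nonnegativity of udist follows from
   the axioms below. *)
HB.mixin Record isUltrametricZmodule (R : realType) U of GRing.Zmodule U := {
  udist : U -> U -> R ;
  udist_eq0 : forall u w, udist u w = 0 <-> u = w ;
  udistC : forall u w, udist u w = udist w u ;
  udist_ultra : forall u v w, udist u w <= Num.max (udist u v) (udist v w) ;
  udistDr : forall v u w, udist (u + v) (w + v) = udist u w
}.

#[short(type="ultrametricZmodType")]
HB.structure Definition UltrametricZmodule (R : realType) :=
  { U of GRing.Zmodule U & isUltrametricZmodule R U }.

Section Packing.
Context {R : realType} {G : zmodType}.
Variables (N : G -> R) (Y : set G).

Definition packing (S : set G) : Prop :=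
  S `<=` [set v | Y v /\ N v < 1] /\
  forall v w, S v -> S w -> v <> w -> 1 <= N (v - w).

(* Maximal cardinality of a packing of the unit ball of the subspace Y of G
   with norm N; by convention 0 if there is no such maximum. *)
Definition packing_number : nat :=
  xget 0%N [set k : nat | (exists2 S, packing S & S #= `I_k) /\
                          (forall S, packing S -> S #<= `I_k)].

End Packing.

Section Quotient.
Context {R : realType} {G : zmodType}.
Variables (N : G -> R) (H : zmodClosed G).

Definition quot_norm (x : Quotient.quot H) : R :=
  inf [set N (repr x - h) | h in [set h : G | h \in H]].

Definition quot_dist (x y : Quotient.quot H) : R := quot_norm (x - y).

End Quotient.

Section BestReturns.
Context {R : realType}.
Variable rho : nat -> R.

Definition next_return (q : nat) : option nat :=
  match pselect (exists q', (q < q')%N && (rho q' < rho q)) with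
  | left ex => Some (ex_minn ex)
  | right _ => None
  end.

(* best_return n = Some q when q_n is defined and equal to q.  Indices start
   at 1, so that index 0 is undefined. *)
Definition best_return (n : nat) : option nat :=
  if n is m.+1 then iter m (obind next_return) (Some 1%N) else None.

End BestReturns.

Section InnerProduct.
Context {R : realType} {V : normedModType R}.
Variable dot : {dot V for idfun}.

Definition orth_compl (A : set V) : set V :=
  [set v | forall a, A a -> dot v a = 0].

Definition orth_proj (A : set V) (v : V) : V :=
  xget 0 [set p | A p /\ orth_compl A (v - p)].

End InnerProduct.

Definition lin_span {R : realType} {V : lmodType R} (A : set V) : set V :=
  [set v | exists n (c : 'I_n -> R) (a : 'I_n -> V),
     (forall i, A (a i)) /\ v = \sum_(i < n) c i *: a i].

Section Setting.
Context {R : realType} {V : normedModType R} {U : ultrametricZmodType R}.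

Definition prod_norm (a : V * U) : R := Num.max `|a.1| (udist a.2 0).

Definition prod_closed (A : set (V * U)) : Prop :=
  forall a, ~ A a -> exists2 e : R, 0 < e &
    forall b, prod_norm (b - a) < e -> ~ A b.

Variable L : zmodClosed (V * U)%type.

Definition return_dist (alpha : Quotient.quot L) (q : nat) : R :=
  quot_dist prod_norm (alpha *+ q) 0.

Definition real_lines : {pred V} :=
  fun v => `[< forall t : R, (t *: v, 0 : U) \in L >].

Lemma real_lines_zmod_closed : zmod_closed real_lines.
Proof.
split=> [|v w /asboolP vL /asboolP wL]; apply/asboolP => t.
  by rewrite scaler0; exact: rpred0.
have -> : (t *: (v - w), 0 : U) = (t *: v, 0) - (t *: w, 0).
  by congr pair; rewrite ?scalerBr ?subr0.
exact: rpredB.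
Qed.

HB.instance Definition _ :=
  GRing.isZmodClosed.Build V real_lines real_lines_zmod_closed.

Lemma real_lines_scaler_closed : GRing.scaler_closed real_lines.
Proof.
by move=> s v /asboolP vL; apply/asboolP => t; rewrite scalerA; exact: vL.
Qed.

HB.instance Definition _ :=
  GRing.isScaleClosed.Build R V real_lines real_lines_scaler_closed.

(* P(V / W): the packing number only involves the additive group and the norm
   of V / W, so the quotient is taken as a quotient of additive groups. *)
Definition packing_reduced : nat :=
  packing_number (quot_norm (fun v : V => `|v|) (H := real_lines)) setT.

Definition effective_factor (dot : {dot V for idfun}) : set V :=
  lin_span [set orth_proj dot (orth_compl dot [set` real_lines]) a.1
           | a in [set a : V * U | a \in L]].

Definition packing_effective (dot : {dot V for idfun}) : nat :=
  packing_number (fun v : V => `|v|) (effective_factor dot).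

End Setting.

(* Main.v *)
From HB Require Import structures.
Require Import Defs.
From mathcomp Require Import all_boot all_order all_algebra finmap.
From mathcomp Require Import all_classical all_reals topology normedtype derive.
From mathcomp Require Import ring lra zify.

Set Implicit Arguments.
Unset Strict Implicit.
Unset Printing Implicit Defensive.

Import Order.TTheory GRing.Theory Num.Theory.
Import numFieldNormedType.Exports.

Local Open Scope classical_set_scope.
Local Open Scope card_scope.
Local Open Scope ring_scope.

(* If [q_(n+P+1) <= q_n + q_(n+1)], the [P+1] multiples [q_i alpha] with
   [n < i <= n+P+1] have size less than [r = rho(q_n)] and mutual distances at
   least [r], because [q_j - q_i <= q_n < q_(n+1)].  Lift them to [V * U] with size less than [r]; the ultrametric
   inequality puts all the separation in the [V]-coordinates, and it survives
   modulo [W], since moving a lift along [W] stays in its coset of the lattice.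
   Rescaling by [r] contradicts the maximality of [P].

   In the Euclidean case, let [z] be the component of [alpha] in [W^perp]
   orthogonal to [E].  The [E]-component of a lift of [q_i alpha] then has
   squared norm less than [r^2 - q_i^2 |z|^2], while squared distances are at
   least [r^2 - (q_j - q_i)^2 |z|^2].  As [q_j - q_i <= q_n < q_i], one rescales
   by the square root of [r^2 - q_n^2 |z|^2]. *)

(** * Best returns of an arbitrary real function of a natural number *)

Section BestReturnTheory.
Context {R : realType}.
Variable rho : nat -> R.

Lemma best_returnS n :
  best_return rho n.+2 = obind (next_return rho) (best_return rho n.+1).
Proof. by []. Qed.

Lemma next_returnP q q' : next_return rho q = Some q' ->
  [/\ (q < q')%N, rho q' < rho q &
      forall p, (q < p < q')%N -> rho q <= rho p].
Proof.
rewrite /next_return; case: pselect => // ex [<-].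
case: ex_minnP => m /andP[qm rm] mmin; split => // p /andP[qp pm].
rewrite leNgt; apply/negP => rp.
by have := mmin p; rewrite qp rp leqNgt pm => /(_ isT).
Qed.

Lemma best_return_defined n c : best_return rho n.+1 = Some c ->
  exists q : nat -> nat,
    forall i, (i <= n)%N -> best_return rho i.+1 = Some (q i).
Proof.
elim: n c => [|n IHn] c.
  by exists (fun=> 1%N) => i; rewrite leqn0 => /eqP->.
rewrite best_returnS; case E: (best_return rho n.+1) => [b|] // nc.
have [q qE] := IHn _ E.
exists (fun i => if (i <= n)%N then q i else c) => i ilen.
case: ifPn => [/qE//|]; rewrite -ltnNge => ni.
have -> : i = n.+1 by apply/eqP; rewrite eqn_leq ilen.
by rewrite best_returnS E.
Qed.

(** [next_return] only controls integers after [q]. Those before [q] follow by induction, since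
    passing to the next record lowers [rho]. *)
Lemma best_return_min n q q' p : best_return rho n.+1 = Some q ->
  best_return rho n.+2 = Some q' -> (0 < p < q')%N -> rho q <= rho p.
Proof.
elim: n q q' p => [|n IHn] q q' p.
  move=> [<-] /next_returnP[_ _ qmin] /andP[p0 pq'].
  have [->//|p1] := eqVneq p 1%N; apply: qmin; lia.
move=> Eq; rewrite best_returnS Eq /=.
move=> /next_returnP[qq' _ qmin] /andP[p0 pq'].
have [pq|qp|->//] := ltngtP p q; last by apply: qmin; rewrite qp.
case E: (best_return rho n.+1) => [b|]; last by rewrite best_returnS E in Eq.
have := Eq; rewrite best_returnS E => /next_returnP[_ /ltW rq _].
by apply: (le_trans rq); apply: IHn E Eq _; rewrite p0.
Qed.

(** All the arithmetic of denominators is isolated here: if the required inequality fails, [P+1]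
    successive denominators starting at [b] crowd into an interval of length at most [a]. *)
Lemma crowded_returns n P c : (0 < n)%N ->
  best_return rho (n + P + 1)%N = Some c ->
  exists a b, [/\ best_return rho n = Some a, best_return rho n.+1 = Some b,
    (a < b)%N &
    (a + b < c)%N \/
    exists2 g : 'I_P.+1 -> nat, (forall i, (b <= g i)%N /\ rho (g i) < rho a) &
      forall i j : 'I_P.+1, (i < j)%N ->
        [/\ (g i < g j)%N, (g j - g i <= a)%N & rho a <= rho (g j - g i)%N]].
Proof.
case: n => // n _; rewrite addn1 => Ec.
(* Now [n] is the predecessor of the original index and [q i] is the denominator of index [i+1];
   thus [a = q n], [b = q n.+1] and [c = q (n.+1 + P)]. *)
have [q qE] := best_return_defined Ec.
have qS i : (i < n.+1 + P)%N -> (q i < q i.+1)%N /\ rho (q i.+1) < rho (q i).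
  move=> ilt; have := qE i.+1 ilt; rewrite best_returnS (qE _ (ltnW ilt)) /=.
  by move=> /next_returnP[].
have qlt i j : (j <= n.+1 + P)%N -> (i < j)%N ->
    (q i < q j)%N /\ rho (q j) < rho (q i).
  elim: j => // j IHj jlt; rewrite ltnS leq_eqVlt => /orP[/eqP->|ij].
    exact: qS.
  have [qj rj] := qS j jlt; have [qi ri] := IHj (ltnW jlt) ij.
  by split; [exact: ltn_trans qj | exact: lt_trans ri].
have Ea : best_return rho n.+1 = Some (q n) by apply: qE; lia.
have Eb : best_return rho n.+2 = Some (q n.+1) by apply: qE; lia.
have cE : c = q (n.+1 + P)%N by apply: Some_inj; rewrite -Ec qE.
exists (q n), (q n.+1); split => //; first by apply: (qlt _ _ _ _).1; lia.
have [|cle] := ltnP (q n + q n.+1) c; [by left | right].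
exists (fun i : 'I_P.+1 => q (n.+1 + i)%N) => [i|i j ij].
  split; last by apply: (qlt _ _ _ _).2; have := ltn_ord i; lia.
  have [->|i0] := posnP i; first by rewrite addn0.
  by apply/ltnW/(qlt _ _ _ _).1; have := ltn_ord i; lia.
have jP := ltn_ord j.
have gij : (q (n.+1 + i) < q (n.+1 + j))%N by apply: (qlt _ _ _ _).1; lia.
have bi : (q n.+1 <= q (n.+1 + i))%N.
  case: (posnP i) => [->|i0]; rewrite ?addn0//.
  by apply/ltnW/(qlt _ _ _ _).1; lia.
have jc : (q (n.+1 + j) <= c)%N.
  rewrite cE; have [->//|jneP] := eqVneq (j : nat) P.
  by apply/ltnW/(qlt _ _ _ _).1; lia.
have ab : (q n < q n.+1)%N by apply: (qlt _ _ _ _).1; lia.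
(* The values of [g] lie between [b] and [c <= a + b], so a difference is at most [a < b], where
   [best_return_min] applies. *)
split => //; first lia.
by apply: best_return_min Ea Eb _; lia.
Qed.

End BestReturnTheory.

(** * Separated families and the packing number *)

Section PackingTheory.
Context {R : realType} {G : zmodType}.
Variables (N : G -> R) (Y : set G).

Definition packing_family m (f : 'I_m -> G) : Prop :=
  (forall i, Y (f i) /\ N (f i) < 1) /\
  (forall i j, i != j -> 1 <= N (f i - f j)).

Lemma packing_family_inj m (f : 'I_m -> G) :
  N 0 = 0 -> packing_family f -> injective f.
Proof.
move=> N0 [_ fsep] i j fij; apply/eqP/negP => /negP/fsep.
by rewrite fij subrr N0 ler10.
Qed.

Lemma packing_family_lt m (f : 'I_m -> G) : (forall x, N (- x) = N x) ->
  (forall i, Y (f i) /\ N (f i) < 1) ->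
  (forall i j : 'I_m, (i < j)%N -> 1 <= N (f j - f i)) -> packing_family f.
Proof.
move=> NN f1 fsep; split=> // i j; rewrite neq_ltn => /orP[/fsep|/fsep //].
by rewrite -NN opprB.
Qed.

Lemma packing_fset (X : {fset G}) : packing N Y [set` X] ->
  exists f : 'I_#|` X| -> G, packing_family f.
Proof.
move=> [Xsub Xsep]; exists (fun i => nth 0 X i).
have inX (i : 'I_#|` X|) : nth 0 X i \in X by rewrite mem_nth.
split=> [i|i j ij]; first by apply: Xsub; exact: inX.
by apply: Xsep; try exact: inX; apply/eqP; rewrite nth_uniq// fset_uniq.
Qed.

(** [packing_number] defaults to 0 when there is no maximum, so some uniform bound [B] must first
    show that the maximum exists. *)
Lemma packing_number_ge B : N 0 = 0 ->
  (forall m (f : 'I_m -> G), packing_family f -> (m <= B)%N) ->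
  forall m (f : 'I_m -> G), packing_family f -> (m <= packing_number N Y)%N.
Proof.
move=> N0 bound m f fP.
have bound_fset (X : {fset G}) : packing N Y [set` X] -> (#|` X| <= B)%N.
  by move=> /packing_fset[g /bound].
have card_packing k : (exists2 S, packing N Y S & S #= `I_k) ->
    exists2 X : {fset G}, packing N Y [set` X] & #|` X| = k.
  move=> [S SP Sk].
  have /finite_fsetP[X SX] : finite_set S by exists k.
  by exists X; [rewrite -SX | apply/card_eq_fsetP; rewrite -SX].
pose Q k := `[< exists2 S, packing N Y S & S #= `I_k >].
have Q0 : exists k, Q k.
  exists 0%N; apply/asboolP; exists set0; last by rewrite II0.
  by split=> // v w [].
have QB k : Q k -> (k <= B)%N.
  by move=> /asboolP/card_packing[X /bound_fset XB <-].
case: (ex_maxnP Q0 QB) => k /asboolP Qk kmax.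
have Kk : [set k : nat | (exists2 S, packing N Y S & S #= `I_k) /\
            (forall S, packing N Y S -> S #<= `I_k)] k.
  split=> // S SP; have [Sfin|Sinf] := pselect (finite_set S).
    have [n Sn] := Sfin.
    rewrite (card_le_eql Sn) card_le_II; apply: kmax.
    by apply/asboolP; exists S.
  (* An infinite packing would contain a finite one with more than [B] points. *)
  have [X XS] := infinite_set_fset B.+1 Sinf.
  rewrite ltnNge bound_fset//; split=> [v Xv|v w Xv Xw].
    by apply: SP.1; exact: XS.
  by apply: SP.2; exact: XS.
have [_ maxP] := xgetPex 0%N (ex_intro _ k Kk).
pose X := [fset f i | i in 'I_m]%fset.
have XP : packing N Y [set` X].
  split=> [_ /imfsetP[/= i _ ->]|]; first exact: fP.1.
  move=> _ _ /imfsetP[/= i _ ->] /imfsetP[/= j _ ->] fij.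
  by apply: fP.2; apply: contra_not_neq fij => ->.
have := maxP _ XP; move=> /geq_card_fset_set.
rewrite set_fsetK card_imfset ?size_enum_ord//=.
exact: packing_family_inj fP.
Qed.

End PackingTheory.

(** * Quotient norms through representatives *)

Section QuotientNorm.
Context {R : realType} {G : zmodType}.
Variables (N : G -> R) (H : zmodClosed G).
Hypothesis N_ge0 : forall x, 0 <= N x.

Local Notation piH := (\pi_(Quotient.quot H)%qT).

Lemma quot_piE (x y : G) : piH x = piH y <-> x - y \in H.
Proof. by rewrite Quotient.idealrBE; split=> [->|/eqP]. Qed.

Lemma quot_norm_has_lbound (x : Quotient.quot H) :
  has_lbound [set N (repr x - h) | h in [set h : G | h \in H]].
Proof. by exists 0 => _ [h _ <-]. Qed.

Lemma quot_norm_nonempty (x : Quotient.quot H) :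
  [set N (repr x - h) | h in [set h : G | h \in H]] !=set0.
Proof. by exists (N (repr x - 0)), 0 => //=; rewrite rpred0. Qed.

(** The infimum need not be attained, but a strict upper bound leaves room for a representative
    below it. *)
Lemma quot_norm_lt (x : Quotient.quot H) r : quot_norm N x < r ->
  exists2 a, piH a = x & N a < r.
Proof.
move=> /(inf_lt (quot_norm_nonempty x))[_ [h /= hH <-] hr].
exists (repr x - h) => //; rewrite -[RHS]reprK; apply/quot_piE.
by rewrite addrAC subrr sub0r rpredN.
Qed.

Lemma quot_norm_le a : quot_norm N (piH a) <= N a.
Proof.
apply: ge_inf; first exact: quot_norm_has_lbound.
exists (repr (piH a) - a) => /=; last by rewrite subKr.
by apply/quot_piE; rewrite reprK.
Qed.

Lemma quot_norm_ge r (x : Quotient.quot H) :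
  (forall a, piH a = x -> r <= N a) -> r <= quot_norm N x.
Proof.
move=> rN; apply: lb_le_inf; first exact: quot_norm_nonempty.
move=> _ [h /= hH <-]; apply: rN; rewrite -[RHS]reprK; apply/quot_piE.
by rewrite addrAC subrr sub0r rpredN.
Qed.

Lemma quot_normN (x : Quotient.quot H) :
  (forall a, N (- a) = N a) -> quot_norm N (- x) = quot_norm N x.
Proof.
move=> NN; suff le_N (y : Quotient.quot H) : quot_norm N (- y) <= quot_norm N y.
  by apply/eqP; rewrite eq_le le_N/= -{1}[x]opprK le_N.
by apply: quot_norm_ge => a <-; rewrite -raddfN -[leRHS]NN quot_norm_le.
Qed.

Lemma quot_norm_ge0 (x : Quotient.quot H) : 0 <= quot_norm N x.
Proof. by apply: quot_norm_ge. Qed.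

Lemma quot_norm0 : N 0 = 0 -> quot_norm N (0 : Quotient.quot H) = 0.
Proof.
move=> N0; apply/eqP; rewrite eq_le quot_norm_ge0 andbT.
by rewrite -[leRHS]N0 -[0 in leLHS](raddf0 piH) quot_norm_le.
Qed.

End QuotientNorm.

(** * Comparison of norms and finiteness of packings in [V] *)

Section FiniteDimension.
Context {R : realType} {d : nat} {V : normedModType R}.
Hypothesis finV : Vector.axiom d V.

(** On the compact unit sphere of the coordinate space, the norm of [V] attains a positive minimum;
    by homogeneity its inverse serves as [K]. *)
Lemma coordinate_bound : exists2 phi : {linear V -> 'rV[R]_d}, injective phi &
  exists (e : 'I_d -> V) (K : R), forall v,
    v = \sum_k phi v 0 k *: e k /\ forall k, `|phi v 0 k| <= K * `|v|.
Proof.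
case: finV => f flin [g fK gK].
pose fl := GRing.isLinear.Build R V 'rV[R]_d _ f flin.
pose phi : {linear V -> 'rV[R]_d} := HB.pack f fl.
exists phi; first exact: can_inj fK.
have glin := can2_linear (f := phi) fK gK.
pose gl := GRing.isLinear.Build R 'rV[R]_d V _ g glin.
pose psi : {linear 'rV[R]_d -> V} := HB.pack g gl.
pose e k := psi (delta_mx 0 k); exists e.
have psiE x : psi x = \sum_k x 0 k *: e k.
  rewrite {1}(row_sum_delta x) linear_sum; apply: eq_bigr => k _.
  by rewrite linearZ.
(* In dimension 0 the sphere is empty, but there are no coordinates to bound. *)
have [d0|d_gt0] := posnP d.
  exists 0 => v; split; first by rewrite -psiE /= fK.
  by move=> k; have := ltn_ord k; rewrite [X in (_ < X)%N]d0.
pose S := [set x : 'rV[R]_d | `|x| = 1].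
have Scpt : compact S.
  apply: bounded_closed_compact.
    exists 1; split => // M M1 x /= ->; exact: ltW.
  apply: (closed_comp (f := fun x : 'rV[R]_d => `|x|) (D := [set 1])).
    by move=> x _; exact: norm_continuous.
  exact: closed_eq.
have psi_cont : continuous (fun x => `|psi x|).
  have -> : (fun x => `|psi x|) = (fun x : 'rV[R]_d => `|\sum_k x 0 k *: e k|).
    by apply/funext => x; rewrite psiE.
  move=> x; apply: (@cvg_norm _ _ _ (nbhs x)).
  apply: (cvg_big (@add_continuous V) (Fa := fun k => x 0 k *: e k)) => k _.
  by apply: cvgZr_tmp; exact: coord_continuous.
have S0 : S !=set0.
  have x0 : (const_mx 1 : 'rV[R]_d) != 0.
    apply/eqP => /rowP/(_ (Ordinal d_gt0)); rewrite !mxE.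
    by apply/eqP; rewrite oner_eq0.
  exists (`|const_mx 1 : 'rV[R]_d|^-1 *: const_mx 1) => /=.
  by rewrite /S /= mx_normZ normfV normr_id mulVf// normr_eq0.
have [x0 x0S x0min] := EVT_min_rV S0 Scpt (continuous_subspaceT psi_cont).
have c_gt0 : 0 < `|psi x0|.
  rewrite normr_gt0; apply/eqP => psi0.
  have x00 : x0 = 0.
    by rewrite -(gK x0) -[g x0]/(psi x0) psi0 -[f]/(phi : V -> _) raddf0.
  by move: x0S; rewrite inE /S /= x00 normr0 => /eqP; rewrite eq_sym oner_eq0.
have coord_le (x : 'rV[R]_d) k : `|x 0 k| <= `|x|.
  by rewrite [leRHS]/Num.norm /= mx_normrE; exact: (le_bigmax _ _ (0, k)).
exists `|psi x0|^-1 => v; split; first by rewrite -psiE /= fK.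
move=> k; apply: le_trans (coord_le _ _) _.
have [->|v0] := eqVneq (phi v) 0; first by rewrite normr0 mulr_ge0 ?invr_ge0.
have nv : 0 < `|phi v| by rewrite normr_gt0.
have /x0min : `|phi v|^-1 *: phi v \in S.
  by rewrite inE /S /= mx_normZ normfV normr_id mulVf// gt_eqF.
rewrite linearZ normrZ normfV normr_id /= fK.
by rewrite ler_pdivlMl// mulrC ler_pdivlMl.
Qed.

(** Pigeonhole: a bounded region of coordinates is cut into finitely many cells, each too small to
    hold two separated points. *)
Lemma separated_bound : exists B, forall m (f : 'I_m -> V),
  packing_family (fun v : V => `|v|) setT f -> (m <= B)%N.
Proof.
have [phi _ [e [K eK]]] := coordinate_bound.
(* [M] exceeds every coordinate of a unit-ball vector, so [t] takes values in [[0, 2Mn)]. Cells have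
   side [1/n], and [n] exceeds the sum of the norms of the [e k], so two points of one cell are at
   distance less than 1. *)
pose n := (Num.truncn (\sum_k `|e k|)).+1; pose M := (Num.truncn `|K|).+1.
exists #|{ffun 'I_d -> 'I_((M + M) * n)}| => m f [f1 fsep].
have n_gt0 : 0 < n%:R :> R by rewrite ltr0n.
pose t i k := (phi (f i) 0 k + M%:R) * n%:R.
have tM i k : 0 <= t i k < ((M + M) * n)%:R.
  have [_ /(_ k) fK] := eK (f i); have [_ fi1] := f1 i.
  have KM : `|K| < M%:R by exact: truncnS_gt.
  have fM : `|phi (f i) 0 k| < M%:R.
    apply: le_lt_trans fK _; apply: le_lt_trans KM.
    by rewrite (le_trans (ler_norm _))// normrM ler_piMr// normr_id ltW.
  move: fM; rewrite ltr_norml => /andP[? ?].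
  by rewrite natrM ltr_pM2r// natrD ltrD2r mulr_ge0// -lerBlDr sub0r ltW.
have tT i k : (Num.truncn (t i k) < (M + M) * n)%N.
  by have /andP[t0 tlt] := tM i k; rewrite truncn_lt_nat.
pose h i := [ffun k => Ordinal (tT i k)].
suff /leq_card : injective h by rewrite card_ord.
move=> i j /ffunP hij; apply/eqP; apply: contraT => /fsep.
rewrite leNgt => /negP[].
have [-> _] := eK (f i - f j).
have close k : `|phi (f i - f j) 0 k| <= n%:R^-1.
  have /(congr1 val) /= := hij k; rewrite !ffunE /= => tij.
  have /andP[ti0 _] := tM i k; have /andP[tj0 _] := tM j k.
  have := truncn_itv ti0; have := truncn_itv tj0.
  rewrite tij -natr1 => /andP[? ?] /andP[? ?].
  have -> : phi (f i - f j) 0 k = (t i k - t j k) / n%:R.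
    rewrite /t -mulrBl mulfK ?gt_eqF// raddfB !mxE. ring.
  rewrite normrM normfV normr_nat ler_piMl ?invr_ge0 ?ltW// ltr_norml.
  by apply/andP; split; lra.
apply: le_lt_trans (ler_norm_sum _ _ _) _.
apply: (@le_lt_trans _ _ (\sum_k n%:R^-1 * `|e k|)).
  by apply: ler_sum => k _; rewrite normrZ ler_wpM2r.
rewrite -mulr_sumr ltr_pdivrMl// mulr1; exact: truncnS_gt.
Qed.

End FiniteDimension.

(** * Orthogonal projection in finite dimension *)

Section InnerProductTheory.
Context {R : realType} {d : nat} {V : normedModType R}.
Hypothesis finV : Vector.axiom d V.
Variable dot : {dot V for idfun}.

Definition subspace (S : set V) : Prop :=
  S 0 /\ forall c x y, S x -> S y -> S (c *: x + y).

Lemma subspaceD S x y : subspace S -> S x -> S y -> S (x + y).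
Proof. by move=> [_ SP] Sx Sy; rewrite -[x]scale1r; exact: SP. Qed.

Lemma subspaceZ S c x : subspace S -> S x -> S (c *: x).
Proof. by move=> [S0 SP] Sx; rewrite -[_ *: _]addr0; exact: SP. Qed.

Lemma subspaceN S x : subspace S -> S x -> S (- x).
Proof. by move=> SP Sx; rewrite -scaleN1r; exact: subspaceZ. Qed.

Lemma subspace_sum S n (F : 'I_n -> V) :
  subspace S -> (forall i, S (F i)) -> S (\sum_i F i).
Proof.
move=> SP SF; elim/big_ind : _ => //; first exact: SP.1.
by move=> x y; exact: subspaceD.
Qed.

Lemma dotC u v : dot u v = dot v u.
Proof. by rewrite hermC /= expr0 mul1r. Qed.

Lemma dotDl u v w : dot (u + v) w = dot u w + dot v w.
Proof. exact: linearDl. Qed.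

Lemma dotBl u v w : dot (u - v) w = dot u w - dot v w.
Proof. exact: linearBl. Qed.

Lemma dotZl c u w : dot (c *: u) w = c * dot u w.
Proof. exact: linearZl_LR. Qed.

Lemma dotDr u v w : dot w (u + v) = dot w u + dot w v.
Proof. exact: linearDr. Qed.

Lemma dotZr c u w : dot w (c *: u) = c * dot w u.
Proof. exact: linearZr_LR. Qed.

Lemma dot0l w : dot 0 w = 0.
Proof. exact: linear0l. Qed.

Lemma dot_eq0 u : dot u u = 0 -> u = 0.
Proof.
move=> u0; apply/eqP/negPn/negP => /(neq0_dnorm_gt0 (s := dot)).
by rewrite u0 ltxx.
Qed.

Lemma dot_suml n (F : 'I_n -> V) w : dot (\sum_i F i) w = \sum_i dot (F i) w.
Proof. exact: linear_sumlz. Qed.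

Lemma orth_compl_subspace A : subspace (orth_compl dot A).
Proof.
split=> [a _|c x y xA yA a Aa]; first exact: dot0l.
by rewrite dotDl dotZl xA// yA// mulr0 addr0.
Qed.

(** Pairing a vanishing combination with [e j] isolates its [j]-th coefficient, so the coordinate
    rows are independent. *)
Lemma orthogonal_family_le n (e : 'I_n -> V) : (forall i, e i != 0) ->
  (forall i j, i != j -> dot (e i) (e j) = 0) -> (n <= d)%N.
Proof.
move=> e0 eorth; have [phi phi_inj _] := coordinate_bound finV.
pose A := \matrix_i phi (e i).
suff : row_free A by move=> /eqP <-; exact: rank_leq_col.
apply: inj_row_free => u uA0; apply/rowP => j; rewrite mxE.
have sum0 : \sum_i u 0 i *: e i = 0.
  apply: phi_inj; rewrite linear0 -uA0 mulmx_sum_row linear_sum.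
  by apply: eq_bigr => i _; rewrite rowK linearZ.
have /eqP : dot (\sum_i u 0 i *: e i) (e j) = 0 by rewrite sum0 dot0l.
rewrite dot_suml (bigD1 j)//= big1 => [|i ij]; last first.
  by rewrite dotZl eorth// mulr0.
rewrite addr0 dotZl mulf_eq0 => /orP[/eqP//|/eqP/dot_eq0/eqP].
by rewrite (negPf (e0 j)).
Qed.

(** No basis of [S] is given; an orthogonal family of maximal size in [S] replaces it, and [p] is
    read off from Fourier coefficients. *)
Lemma orth_decomposition S v : subspace S ->
  exists2 p, S p & forall a, S a -> dot (v - p) a = 0.
Proof.
move=> SP.
pose fam n (e : 'I_n -> V) := [/\ forall i, S (e i), forall i, e i != 0 &
  forall i j, i != j -> dot (e i) (e j) = 0].
pose Q n := `[< exists e : 'I_n -> V, fam n e >].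
have Q0 : exists n, Q n.
  by exists 0%N; apply/asboolP; exists (fun=> 0); split; case.
have Qd n : Q n -> (n <= d)%N.
  by move=> /asboolP[e [_ e0 eorth]]; exact: orthogonal_family_le e0 eorth.
case: (ex_maxnP Q0 Qd) => n /asboolP[e [eS e0 eorth]] nmax.
pose p w := \sum_i (dot w (e i) / dot (e i) (e i)) *: e i.
have pS w : S (p w) by apply: subspace_sum => // i; exact: subspaceZ.
have p_orth w j : dot (w - p w) (e j) = 0.
  rewrite dotBl dot_suml (bigD1 j)//= big1 => [|i ij]; last first.
    by rewrite dotZl eorth// mulr0.
  rewrite addr0 dotZl divfK ?subrr//.
  by apply: contra (e0 j) => /eqP/dot_eq0/eqP.
(* A nonzero residual [a - p a] would lie in [S], be orthogonal to the family, and enlarge it. *)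
have p_id a : S a -> a = p a.
  move=> Sa; apply/eqP; rewrite -subr_eq0; apply: contraT => r0.
  suff /nmax : Q n.+1 by rewrite ltnn.
  apply/asboolP.
  exists (fun i => if unlift ord0 i is Some j then e j else a - p a).
  split=> [i|i|i j].
  - case: unliftP => [j|] _ //; apply: subspaceD => //; exact: subspaceN.
  - by case: unliftP.
  - case: unliftP => [i'|] ->; case: unliftP => [j'|] -> ij.
    + by apply: eorth; apply: contra_neq ij => ->.
    + by rewrite dotC p_orth.
    + by rewrite p_orth.
    + by rewrite eqxx in ij.
exists (p v) => // a /p_id ->; rewrite dotC dot_suml big1// => i _.
by rewrite dotZl [dot _ (v - _)]dotC p_orth mulr0.
Qed.

(** [orth_proj] is an [xget] with default 0, so a valid value must be exhibited: [v] minus its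
    projection to [S]. The chosen value only puts [v - p] in the double complement of [S];
    identifying it with [w] puts it in [S]. *)
Lemma orth_projP S v : subspace S ->
  orth_compl dot S (orth_proj dot (orth_compl dot S) v) /\
  S (v - orth_proj dot (orth_compl dot S) v).
Proof.
move=> SP; have [w Sw wP] := orth_decomposition v SP.
have ex : exists p,
    orth_compl dot S p /\ orth_compl dot (orth_compl dot S) (v - p).
  exists (v - w); split=> [a /wP//|a aP]; rewrite subKr dotC; exact: aP.
have [pP vpP] := xgetPex 0 ex.
rewrite -/(orth_proj dot (orth_compl dot S) v) in pP vpP *.
set p := orth_proj _ _ _ in pP vpP *; split => //.
suff -> : v - p = w by [].
apply/eqP; rewrite -subr_eq0; apply/eqP/dot_eq0.
(* The difference [v - p - w] lies in the complement of [S], to which both [v - p] and [w] are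
   orthogonal; hence it is orthogonal to itself. *)
have dP : orth_compl dot S (v - p - w).
  rewrite addrAC; apply: (subspaceD (orth_compl_subspace S)); first exact: wP.
  exact: (subspaceN (orth_compl_subspace S)).
by rewrite dotBl vpP// [dot w _]dotC dP// subrr.
Qed.

Lemma lin_span_subspace (A : set V) : subspace (lin_span A).
Proof.
split.
  by exists 0%N, (fun=> 0), (fun=> 0); split; [case | rewrite big_ord0].
move=> c _ _ [n [cx [ax [axA ->]]]] [m [cy [ay [ayA ->]]]].
exists (n + m)%N, (fun i =>
    match fintype.split i with inl j => c * cx j | inr j => cy j end),
  (fun i => match fintype.split i with inl j => ax j | inr j => ay j end).
split; first by move=> i; case: fintype.split.
rewrite big_split_ord /= scaler_sumr; congr (_ + _); apply: eq_bigr => i _.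
  by rewrite -[lshift _ _]/(unsplit (inl i)) unsplitK scalerA.
by rewrite -[rshift _ _]/(unsplit (inr i)) unsplitK.
Qed.

Lemma lin_span_incl (A : set V) : A `<=` lin_span A.
Proof.
move=> a Aa; exists 1%N, (fun=> 1), (fun=> a); split => //.
by rewrite big_ord1 scale1r.
Qed.

Lemma lin_span_sub (A S : set V) : subspace S -> A `<=` S -> lin_span A `<=` S.
Proof.
move=> SP AS _ [n [c [a [aA ->]]]]; apply: subspace_sum => // i.
by apply: subspaceZ => //; exact: AS.
Qed.

End InnerProductTheory.

(** * Lifting returns to [V * U], and the packing in the reduced factor *)

Section Setting.
Context {R : realType} {V : normedModType R} {U : ultrametricZmodType R}.
Variable L : zmodClosed (V * U)%type.

Local Notation piL := (\pi_(Quotient.quot L)%qT).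
Local Notation N := (@prod_norm R V U).

Lemma prod_norm_ge0 (a : V * U) : 0 <= N a.
Proof. by rewrite /prod_norm le_max normr_ge0. Qed.

Lemma udistB (u w : U) :
  udist (u - w) 0 <= Num.max (udist u 0 : R) (udist w 0).
Proof.
rewrite -(udistDr w) subrK add0r; apply: le_trans (udist_ultra u 0 w) _.
by rewrite [udist 0 w]udistC.
Qed.

Lemma return_distE (alpha : Quotient.quot L) q :
  return_dist alpha q = quot_norm N (alpha *+ q).
Proof. by rewrite /return_dist /quot_dist subr0. Qed.

Lemma return_lift (alpha : Quotient.quot L) q r : return_dist alpha q < r ->
  exists2 a, piL a = alpha *+ q & N a < r.
Proof. by rewrite return_distE => /quot_norm_lt. Qed.

(* The ultrametric factor cannot separate two lifts of size [< r], so their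
   distance is carried by the real factor. *)
Lemma lift_gap (alpha : Quotient.quot L) (p q : nat) (r : R) (a b c : V * U) :
  (p < q)%N -> r <= return_dist alpha (q - p)%N ->
  piL a = alpha *+ p -> piL b = alpha *+ q -> N a < r -> N b < r ->
  c - (b - a) \in L -> c.2 = b.2 - a.2 -> r <= `|c.1|.
Proof.
move=> pq rpq aE bE ar br cL c2.
have cE : piL c = alpha *+ (q - p)%N.
  by rewrite mulrnBr ?(ltnW pq)// -aE -bE -raddfB; exact/quot_piE.
have : r <= N c.
  apply: (le_trans rpq); rewrite return_distE -cE.
  exact: (@quot_norm_le _ _ N L prod_norm_ge0 c).
rewrite {1}/prod_norm le_max => /orP[//|].
move: ar br; rewrite /prod_norm !gt_max => /andP[_ a2] /andP[_ b2].
by rewrite c2 => /le_trans/(_ (udistB _ _)); rewrite le_max leNgt b2 leNgt a2.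
Qed.

Lemma reduced_packing (alpha : Quotient.quot L) r m (g : 'I_m -> nat) :
  (forall i, return_dist alpha (g i) < r) ->
  (forall i j : 'I_m, (i < j)%N ->
     (g i < g j)%N /\ r <= return_dist alpha (g j - g i)%N) ->
  exists f : 'I_m -> Quotient.quot (real_lines L),
    packing_family (quot_norm (fun v : V => `|v|) (H := real_lines L)) setT f.
Proof.
move=> gr gsep.
have lift i : exists a, piL a = alpha *+ g i /\ N a < r.
  by have [a] := return_lift (gr i); exists a.
have [a aP] := boolp.choice lift.
have nn : forall x : V, 0 <= `|x| by [].
(* With [m = 0] there is no lift from which to deduce [r > 0]. *)
case: m g gr gsep lift a aP => [|m] g gr gsep lift a aP.
  by exists (fun=> 0); split; case.
have r_gt0 : 0 < r := le_lt_trans (prod_norm_ge0 _) (aP ord0).2.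
exists (fun i => \pi_(Quotient.quot (real_lines L))%qT (r^-1 *: (a i).1)).
apply: packing_family_lt => [x|i|i j ij].
- by apply: quot_normN => // v; exact: normrN.
- split=> //; apply: le_lt_trans (quot_norm_le _ nn _) _.
  rewrite normrZ gtr0_norm ?invr_gt0// ltr_pdivrMl// mulr1.
  by apply: le_lt_trans (aP i).2; rewrite le_max lexx.
- rewrite -raddfB; apply: quot_norm_ge => // v /quot_piE vW.
  have [gij rij] := gsep _ _ ij.
  (* [v] is any representative of the difference of classes. Once rescaled, it differs from the
     difference of the lifts by a vector of [W], so [c] stays in the same coset of [L]. *)
  pose c : V * U := (r *: v, (a j).2 - (a i).2).
  suff : r <= `|c.1| by rewrite /= normrZ gtr0_norm// ler_pMr.
  apply: (lift_gap gij rij (aP i).1 (aP j).1 (aP i).2 (aP j).2) => //.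
  have /asboolP/(_ r) :
    v - (r^-1 *: (a j).1 - r^-1 *: (a i).1) \in real_lines L := vW.
  congr (_ \in L); congr pair; rewrite /=; last by rewrite subrr.
  by rewrite !scalerBr !scalerA mulfV ?gt_eqF// !scale1r.
Qed.

Lemma real_lines_subspace : subspace [set` real_lines L].
Proof.
split=> [|c x y xL yL] /=; first exact: rpred0.
by apply: rpredD => //; exact: rpredZ.
Qed.

(** * The Euclidean case: packing in the effective factor *)

Section EffectiveFactor.
Variables (d : nat) (dot : {dot V for idfun}).
Hypothesis finV : Vector.axiom d V.
Hypothesis normE : forall v : V, `|v| ^+ 2 = dot v v.

Local Notation W := [set` real_lines L].
Local Notation E := (effective_factor L dot).

Lemma norm_sqrD u v : dot u v = 0 -> `|u + v| ^+ 2 = `|u| ^+ 2 + `|v| ^+ 2.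
Proof.
by move=> uv; rewrite !normE dotDl !dotDr uv [dot v u]dotC uv addr0 add0r.
Qed.

Lemma effective_factor_orth : E `<=` orth_compl dot W.
Proof.
apply: lin_span_sub; first exact: orth_compl_subspace.
by move=> _ [a _ <-]; apply: (orth_projP finV dot _ real_lines_subspace).1.
Qed.

(* The part [z] of [alpha] orthogonal to [E] is common to all lifts of
   multiples of [alpha], as lattice vectors project into [E]. *)
Lemma effective_splitting (alpha : Quotient.quot L) :
  exists z, (forall p, E p -> dot p z = 0) /\
    forall q a, piL a = alpha *+ q -> exists w p,
      [/\ real_lines L w, E p, a.1 = w + (p + q%:R *: z) &
          dot w (p + q%:R *: z) = 0].
Proof.
have Esub : subspace E by exact: lin_span_subspace.
have Wsub := real_lines_subspace.
pose v := (repr alpha).1; pose pr := orth_proj dot (orth_compl dot W).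
have prP x : orth_compl dot W (pr x) /\ W (x - pr x).
  exact: (orth_projP finV dot x Wsub).
have [e Ee eP] := orth_decomposition finV dot v Esub.
exists (pr v - e); split=> [p Ep|q a aE].
  (* The term [v - e] is orthogonal to [E] by the choice of [e]; the term [v - pr v] lies in [W],
     hence is orthogonal to [E] too. *)
  have -> : pr v - e = (v - e) - (v - pr v) by rewrite opprB [RHS]addrC subrKA.
  rewrite dotC dotBl eP// sub0r dotC effective_factor_orth ?oppr0//.
  exact: (prP v).2.
(* The lattice vector separating the lift from [q] times a fixed representative of [alpha]; its
   projection belongs to [E]. *)
pose l := a - repr alpha *+ q.
have lL : l \in L by apply/quot_piE; rewrite raddfMn/= reprK.
have aE1 : a.1 = q%:R *: v + l.1.
  rewrite scaler_nat /v /l /= -[X in X + _]/((repr alpha).1 *+ q).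
  by rewrite raddfMn /= addrC subrK.
(* [x] and [w] are the components of [a.1] in the complement of [W] and in [W]. Writing [pr v] as
   [e] plus the witness [pr v - e] splits [x] into its [E]-part and the multiple of [z]. *)
pose x := q%:R *: pr v + pr l.1.
pose w := q%:R *: (v - pr v) + (l.1 - pr l.1).
have xE : q%:R *: e + pr l.1 + q%:R *: (pr v - e) = x.
  by rewrite addrAC -scalerDr subrKC.
exists w, (q%:R *: e + pr l.1); rewrite xE; split.
- by apply: (subspaceD Wsub); [apply: (subspaceZ _ Wsub) |]; apply: (prP _).2.
- apply: (subspaceD Esub); first exact: subspaceZ.
  by apply: lin_span_incl; exists l.
- by rewrite aE1 /w /x scalerBr addrACA !subrK.
- rewrite dotC; have xW : orth_compl dot W x.
    have WCsub := orth_compl_subspace dot W.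
    by apply: (subspaceD WCsub); [apply: (subspaceZ _ WCsub) |]; apply: (prP _).1.
  apply: xW.
  by apply: (subspaceD Wsub); [apply: (subspaceZ _ Wsub) |]; apply: (prP _).2.
Qed.

Lemma effective_packing (alpha : Quotient.quot L) r A m (g : 'I_m.+1 -> nat) :
  (forall i, (A < g i)%N /\ return_dist alpha (g i) < r) ->
  (forall i j : 'I_m.+1, (i < j)%N -> [/\ (g i < g j)%N, (g j - g i <= A)%N &
     r <= return_dist alpha (g j - g i)%N]) ->
  exists f : 'I_m.+1 -> V, packing_family (fun v : V => `|v|) E f.
Proof.
move=> gr gsep; have [z [Ez splitting]] := effective_splitting alpha.
have lift i : exists awp : (V * U) * V * V, let: (a, w, p) := awp in
    [/\ piL a = alpha *+ g i, N a < r, real_lines L w, E p &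
        a.1 = w + (p + (g i)%:R *: z) /\ dot w (p + (g i)%:R *: z) = 0].
  have [a aE ar] := return_lift (gr i).2.
  by have [w [p [Ww Ep a1 wp]]] := splitting _ _ aE; exists (a, w, p).
have [awp awpP] := boolp.choice lift.
pose a i := (awp i).1.1; pose w i := (awp i).1.2; pose p i := (awp i).2.
have {awpP}P i : [/\ piL (a i) = alpha *+ g i, N (a i) < r,
    real_lines L (w i), E (p i) &
    (a i).1 = w i + (p i + (g i)%:R *: z) /\
    dot (w i) (p i + (g i)%:R *: z) = 0].
  by have := awpP i; rewrite /a /w /p; case: (awp i) => -[].
have Esub : subspace E by exact: lin_span_subspace.
have sqrE x t : E x -> `|x + t *: z| ^+ 2 = `|x| ^+ 2 + t ^+ 2 * `|z| ^+ 2.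
  move=> Ex; rewrite norm_sqrD; last by rewrite dotZr Ez// mulr0.
  by rewrite normrZ exprMn real_normK ?num_real.
have r_gt0 : 0 < r.
  by have [_ ar _ _ _] := P ord0; apply: le_lt_trans ar; exact: prod_norm_ge0.
(* One radius serves twice: [A < g i] bounds the sizes above, and [g j - g i <= A] bounds the
   separations below. *)
pose s2 := r ^+ 2 - A%:R ^+ 2 * `|z| ^+ 2.
have p_lt i : `|p i| ^+ 2 < s2.
  have [_ ar _ Ep [a1 wp]] := P i; have [Ag _] := gr i.
  have : `|(a i).1| ^+ 2 < r ^+ 2.
    rewrite ltr_pXn2r ?nnegrE ?(ltW r_gt0)//; apply: le_lt_trans ar.
    by rewrite le_max lexx.
  rewrite a1 norm_sqrD// sqrE// /s2 => h.
  have : A%:R ^+ 2 * `|z| ^+ 2 <= (g i)%:R ^+ 2 * `|z| ^+ 2.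
    by rewrite ler_wpM2r ?sqr_ge0// lerXn2r ?nnegrE// ler_nat ltnW.
  have := sqr_ge0 `|w i|; lra.
(* Positivity comes from the family being nonempty. *)
have s2_gt0 : 0 < s2 by apply: le_lt_trans (p_lt ord0); rewrite sqr_ge0.
pose s := Num.sqrt s2.
have s_gt0 : 0 < s by rewrite sqrtr_gt0.
have s2E : s ^+ 2 = s2 by rewrite sqr_sqrtr// ltW.
exists (fun i => s^-1 *: p i).
apply: packing_family_lt => [x|i|i j ij]; first exact: normrN.
  have [_ _ _ Ep _] := P i; split; first exact: subspaceZ.
  rewrite normrZ gtr0_norm ?invr_gt0// ltr_pdivrMl// mulr1.
  by rewrite -(ltr_pXn2r (n := 2)) ?nnegrE ?(ltW s_gt0)// s2E.
rewrite -scalerBr normrZ gtr0_norm ?invr_gt0// ler_pdivlMl// mulr1.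
rewrite -(ler_pXn2r (n := 2)) ?nnegrE ?(ltW s_gt0)// s2E.
have [gij gA rij] := gsep _ _ ij.
have [aiE ai_r wi pi [ai1 _]] := P i; have [ajE aj_r wj pj [aj1 _]] := P j.
have Ep : E (p j - p i) by apply: (subspaceD Esub) => //; exact: subspaceN.
(* The [W]-components of the lifts are dropped. This changes the difference of the lifts by
   [w i - w j] in [W], so [lift_gap] still applies. *)
pose c : V * U := (p j - p i + (g j - g i)%:R *: z, (a j).2 - (a i).2).
have : r <= `|c.1|.
  apply: (lift_gap gij rij aiE ajE ai_r aj_r) => //.
  have c1E : c.1 - ((a j).1 - (a i).1) = w i - w j.
    have -> : c.1 = (p j + (g j)%:R *: z) - (p i + (g i)%:R *: z).
      by rewrite /c [LHS]/= (natrB _ (ltnW gij)) scalerBl opprD addrACA.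
    rewrite ai1 aj1; move: (p j + _) (p i + _) => y x.
    rewrite [- (_ - _)]opprB [- (w j + y)]opprD [w i + x + _]addrACA.
    by rewrite addrC -[y - x]opprB addKr.
  have /asboolP/(_ 1) : w i - w j \in real_lines L by exact: rpredB.
  by rewrite scale1r -c1E; congr (_ \in L); congr pair; rewrite [RHS]/= subrr.
move=> rc; have : r ^+ 2 <= `|c.1| ^+ 2 by rewrite lerXn2r ?nnegrE ?(ltW r_gt0).
rewrite sqrE// /s2 => h.
have : (g j - g i)%:R ^+ 2 * `|z| ^+ 2 <= A%:R ^+ 2 * `|z| ^+ 2.
  by rewrite ler_wpM2r ?sqr_ge0// lerXn2r ?nnegrE// ler_nat.
lra.
Qed.

End EffectiveFactor.

End Setting.

(** * The two inequalities for best-return denominators *)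

Theorem proposition2 (R : realType) (d : nat) (V : normedModType R)
    (U : ultrametricZmodType R) (L : zmodClosed (V * U)%type)
    (alpha : Quotient.quot L) :
  (1 <= d)%N -> Vector.axiom d V -> prod_closed [set a : V * U | a \in L] ->
  (forall n c : nat, (1 <= n)%N ->
     best_return (return_dist alpha) (n + packing_reduced L + 1)%N = Some c ->
     exists a b : nat,
       [/\ best_return (return_dist alpha) n = Some a,
           best_return (return_dist alpha) n.+1 = Some b &
           (a + b < c)%N]) /\
  (forall dot : {dot V for idfun}, (forall v : V, `|v| ^+ 2 = dot v v) ->
   forall n c : nat, (1 <= n)%N ->
     best_return (return_dist alpha) (n + packing_effective L dot + 1)%N
       = Some c ->
     exists a b : nat,
       [/\ best_return (return_dist alpha) n = Some a,
           best_return (return_dist alpha) n.+1 = Some b &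
           (a + b < c)%N]).
Proof.
move=> _ finV _; have [B boundB] := separated_bound finV.
split=> [n c n_gt0|dot normE n c n_gt0] /(crowded_returns n_gt0).
- move=> [a [b [Ea Eb _ [abc|[g gb gsep]]]]]; first by exists a, b.
  have nn (x : V) : 0 <= `|x| by [].
  have gsep_lt (i j : 'I_(packing_reduced L).+1) : (i < j)%N ->
      (g i < g j)%N /\ return_dist alpha a <= return_dist alpha (g j - g i)%N.
    by move=> /gsep[].
  have [f fP] := reduced_packing (fun i => (gb i).2) gsep_lt.
  suff : ((packing_reduced L).+1 <= packing_reduced L)%N by rewrite ltnn.
  apply: (packing_number_ge (B := B)) fP.
    by apply: quot_norm0 => //; exact: normr0.
  (* The bound [B] passes from [V] to [V / W]: classes of norm less than 1 lift to vectors of norm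
     less than 1, and lifting does not decrease distances. *)
  move=> m h [h1 hsep].
  have lift i : exists v : V,
      \pi_(Quotient.quot (real_lines L))%qT v = h i /\ `|v| < 1.
    by have [v] := quot_norm_lt (h1 i).2; exists v.
  have [v vP] := boolp.choice lift.
  apply: (boundB m v); split=> [i|i j /hsep].
    by split=> //; exact: (vP i).2.
  rewrite -(vP i).1 -(vP j).1 -raddfB => /le_trans; apply.
  exact: (@quot_norm_le _ _ (fun x : V => `|x|) (real_lines L) nn).
- move=> [a [b [Ea Eb ab [abc|[g gb gsep]]]]]; first by exists a, b.
  have gb_lt i : (a < g i)%N /\ return_dist alpha (g i) < return_dist alpha a.
    by have [bg ?] := gb i; split=> //; exact: leq_trans bg.
  have [f fP] := effective_packing finV normE gb_lt gsep.
  suff : ((packing_effective L dot).+1 <= packing_effective L dot)%N.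
    by rewrite ltnn.
  apply: (packing_number_ge (B := B)) fP; first exact: normr0.
  move=> m h [h1 hsep]; apply: (boundB m h); split=> // i.
  by split=> //; exact: (h1 i).2.
Qed.
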